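(* Let $k\ge 1$, let $h_1\ge h_2\ge\dots\ge h_k\ge 1$ be integers, let $n\ge \sum_{i=1}^k h_i$ be an integer, and put $h_{k+1}=n-\sum_{i=1}^k h_i$. If an $\mathrm{ILS}(n;h_1\dots h_k)$ exists, then for all pairwise disjoint subsets $A,B,C,D$ of $[k+1]$, writing $E=A\cup B\cup C\cup D$ and $\overline{E}=[k+1]\setminus E$, $$\left(\sum_{i\in A\cup C}h_i\right)^2+\left(\sum_{i\in B\cup D}h_i\right)^2-\sum_{i\in E\setminus\{k+1\}}h_i^2\;\ge\;\left(\sum_{i\in A\cup D}h_i\right)\left(\sum_{i\in B\cup C}h_i-\sum_{j\in\overline{E}}h_j\right).$$
   Context: $[m]=\{1,\dots,m\}$. A latin square of order $n$ is an $n\times n$ array filled with symbols from $[n]$ such that each symbol occurs exactly once in every row and every column. A subsquare of order $m$ is an $m\times m$ subarray (given by a set of $m$ rows and a set of $m$ columns, not necessarily consecutive) which is itself a latin square of order $m$ on some set of $m$ symbols. Subsquares are disjoint if they share no rows, no columns and no symbols. For positive integers $h_1,\dots,h_k$ with $h_1+\dots+h_k\le n$, an incomplete latin square $\mathrm{ILS}(n;h_1\dots h_k)$ is a (completely filled) latin square of order $n$ with $k$ pairwise disjoint subsquares of orders $h_1,\dots,h_k$. *)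

(* Defs.v *)
From mathcomp Require Import all_boot all_order all_algebra.

Set Implicit Arguments.
Unset Strict Implicit.
Unset Printing Implicit Defensive.

(* Rows, columns and symbols range over 'I_n = {0, ..., n-1} instead of [n]. *)

(* The subarray of L with rows R and columns C is a latin square on S. *)
Definition latin_on n (L : 'M['I_n]_n) (R C S : {set 'I_n}) : Prop :=
  [/\ forall r c, r \in R -> c \in C -> L r c \in S,
      forall r s, r \in R -> s \in S -> #|[set c in C | L r c == s]| = 1
    & forall c s, c \in C -> s \in S -> #|[set r in R | L r c == s]| = 1].

Definition latin_square n (L : 'M['I_n]_n) : Prop :=
  latin_on L [set: 'I_n] [set: 'I_n] [set: 'I_n].

Definition subsquare n (L : 'M['I_n]_n) (m : nat) (R C S : {set 'I_n}) : Prop :=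
  [/\ #|R| = m, #|C| = m, #|S| = m & latin_on L R C S].

(* [ILS n h] asserts the existence of an ILS(n; h_1 ... h_k); the i-th
   subsquare has row set R i, column set C i and symbol set S i. *)
Definition ILS (n k : nat) (h : 'I_k -> nat) : Prop :=
  exists (L : 'M['I_n]_n) (R C S : 'I_k -> {set 'I_n}),
    [/\ latin_square L,
        forall i, subsquare L (h i) (R i) (C i) (S i)
      & forall i j, i != j ->
          [/\ [disjoint R i & R j], [disjoint C i & C j]
            & [disjoint S i & S j]]].

(* Extension of h_1, ..., h_k by h_{k+1} = n - (h_1 + ... + h_k); the index
   k+1 is [ord_max : 'I_k.+1]. The subtraction is truncated, hence meaningful
   only when the sum is at most n. *)
Definition hext (n k : nat) (h : 'I_k -> nat) (i : 'I_k.+1) : nat :=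
  if unlift ord_max i is Some j then h j else n - \sum_(j < k) h j.

(* Main.v *)
Require Import Defs.
From mathcomp Require Import all_boot all_order all_algebra.
From mathcomp Require Import ring lra.

Set Implicit Arguments.
Unset Strict Implicit.
Unset Printing Implicit Defensive.

Import Order.TTheory GRing.Theory Num.Theory.
Local Open Scope ring_scope.

(* Give every row, column and symbol its class in [k+1]. The difference of the
   two sides, without the sum of squares, is a quadratic form
   sum_(i, j) T i j h_i h_j. The sum
     T r c + T c r + T c s + T s c + T r s + T s r
   is nonnegative for all classes r, c, s. Summing it over all cells of the
   square gives six times the quadratic form, because any two of row, column
   and symbol determine the cell; the cells of the i-th subsquare alone
   contribute 6 h_i^2 T i i. *)

(** The default class [ord_max], the index $k+1$, collects what lies outside every [P i]. The pick
    is unambiguous once the [P i] are disjoint. *)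
Definition block n k (P : 'I_k -> {set 'I_n}) (x : 'I_n) : 'I_k.+1 :=
  if [pick i | x \in P i] is Some i then lift ord_max i else ord_max.

Lemma block_lift n k (P : 'I_k -> {set 'I_n}) x i :
  (forall i j, i != j -> [disjoint P i & P j]) ->
  (block P x == lift ord_max i) = (x \in P i).
Proof.
move=> dP; rewrite /block; case: pickP => [j xj | xN].
  rewrite (inj_eq lift_inj); have [<- // | ji] := eqVneq j i.
  by rewrite (disjointFr (dP _ _ ji) xj).
by rewrite xN (negbTE (neq_lift _ _)).
Qed.

(** The fibre over a lifted index is [P j]. The fibres partition ['I_n], so the last one has the
    remaining [n - \sum_(j < k) h j] elements. *)
Lemma card_block n k (P : 'I_k -> {set 'I_n}) (h : 'I_k -> nat) i :
  (forall i j, i != j -> [disjoint P i & P j]) -> (forall i, #|P i| = h i) ->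
  #|[pred x | block P x == i]| = hext n h i.
Proof.
move=> dP cP.
have cl j : #|[pred x | block P x == lift ord_max j]| = h j.
  by rewrite -cP; apply: eq_card => x; rewrite inE block_lift.
rewrite /hext; case: unliftP => [j ->|->]; first exact: cl.
have En : n = (\sum_(i < k.+1) #|[pred x | block P x == i]|)%N.
  rewrite -[LHS]card_ord -sum1_card (partition_big (block P) predT) //=.
  by apply: eq_bigr => j _; rewrite -sum1_card.
rewrite (bigD1_ord ord_max) //= (eq_bigr h) in En; last by move=> j _; apply: cl.
by move/(congr1 (subn^~ (\sum_(j < k) h j)%N)): En; rewrite /= addnK => ->.
Qed.

Lemma latin_row_inj n (L : 'M['I_n]_n) r : latin_square L -> injective (L r).
Proof.
case=> _ Lr _ c c' e; have /eqP/cards1P[d Ed] := Lr r (L r c) (in_setT _) (in_setT _).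
have: c \in [set d] by rewrite -Ed !inE eqxx.
have: c' \in [set d] by rewrite -Ed !inE e eqxx.
by rewrite !inE => /eqP-> /eqP->.
Qed.

Lemma latin_col_inj n (L : 'M['I_n]_n) c : latin_square L -> injective (L^~ c).
Proof.
case=> _ _ Lc r r' e; have /eqP/cards1P[d Ed] := Lc c (L r c) (in_setT _) (in_setT _).
have: r \in [set d] by rewrite -Ed !inE eqxx.
have: r' \in [set d] by rewrite -Ed !inE e eqxx.
by rewrite !inE => /eqP-> /eqP->.
Qed.

Lemma sum_by_class n m (t : 'I_n -> 'I_m) (w : 'I_m -> nat) (G : 'I_m -> int) :
  (forall i, #|[pred x | t x == i]| = w i) ->
  \sum_x G (t x) = \sum_i (w i)%:Z * G i.
Proof.
move=> cw; rewrite (partition_big t predT) //=; apply: eq_bigr => i _.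
under eq_bigr => x /eqP-> do [].
by rewrite sumr_const cw -mulr_natl natz.
Qed.

Lemma ILS_quadratic_form n k (h : 'I_k -> nat) (T : 'I_k.+1 -> 'I_k.+1 -> int) :
  ILS n h ->
  (forall r c s, 0 <= T r c + T c r + (T c s + T s c) + (T r s + T s r)) ->
  \sum_(i | i != ord_max) (hext n h i)%:Z ^+ 2 * T i i
    <= \sum_i \sum_j (hext n h i)%:Z * (hext n h j)%:Z * T i j.
Proof.
case=> L [R] [C] [S] [latL sub dis] T_ge0.
have dR i j : i != j -> [disjoint R i & R j] by case/dis.
have dC i j : i != j -> [disjoint C i & C j] by case/dis.
have dS i j : i != j -> [disjoint S i & S j] by case/dis.
have cR i : #|[pred x | block R x == i]| = hext n h i.
  by apply: card_block => // j; case: (sub j).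
have cC i : #|[pred x | block C x == i]| = hext n h i.
  by apply: card_block => // j; case: (sub j).
have cS i : #|[pred x | block S x == i]| = hext n h i.
  by apply: card_block => // j; case: (sub j).
set Q := leRHS.
(* Over independent [x] and [y], the class pair $(i,j)$ occurs $h_i h_j$ times. The factor 2 comes
   from adding [T] and its transpose. *)
have sumQ (t u : 'I_n -> 'I_k.+1) :
    (forall i, #|[pred x | t x == i]| = hext n h i) ->
    (forall i, #|[pred x | u x == i]| = hext n h i) ->
    \sum_x \sum_y (T (t x) (u y) + T (u y) (t x)) = Q *+ 2.
  move=> ct cu.
  under eq_bigr => x _ do
    rewrite (sum_by_class (fun j => T (t x) j + T j (t x)) cu).
  rewrite (sum_by_class (fun i =>
    \sum_j (hext n h j)%:Z * (T i j + T j i)) ct).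
  transitivity (Q + \sum_i \sum_j (hext n h i)%:Z * (hext n h j)%:Z * T j i).
    rewrite -big_split; apply: eq_bigr => i _ /=.
    rewrite -big_split big_distrr; apply: eq_bigr => j _ /=; ring.
  rewrite mulr2n; congr (_ + _); rewrite exchange_big.
  by apply: eq_bigr => i _; apply: eq_bigr => j _; congr (_ * _); apply: mulrC.
pose F (r c : 'I_n) (a := block R r) (b := block C c) (s := block S (L r c)) :=
  T a b + T b a + (T b s + T s b) + (T a s + T s a).
have F_ge0 r c : 0 <= F r c by apply: T_ge0.
have sumF : \sum_r \sum_c F r c = Q *+ 6.
  have -> : Q *+ 6 = Q *+ 2 + Q *+ 2 + Q *+ 2 by rewrite -!mulrnDr.
  rewrite -{1}(sumQ _ _ cR cC) -{1}(sumQ _ _ cC cS) -(sumQ _ _ cR cS).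
  (* In a fixed column [L r c] runs once through all symbols, so the column-symbol sum is a sum over
     cells. Fixed rows then do the same for the row-symbol sum. *)
  rewrite -[X in _ + X + _](_ : \sum_r \sum_c
    (T (block C c) (block S (L r c)) + T (block S (L r c)) (block C c)) = _); last first.
    rewrite exchange_big; apply: eq_bigr => c _ /=.
    by rewrite [RHS](reindex_inj (@latin_col_inj _ _ c latL)).
  rewrite -[X in _ + _ + X](_ : \sum_r \sum_c
    (T (block R r) (block S (L r c)) + T (block S (L r c)) (block R r)) = _); last first.
    apply: eq_bigr => r _ /=.
    by rewrite [RHS](reindex_inj (@latin_row_inj _ _ r latL)).
  by rewrite -!big_split; apply: eq_bigr => r _; rewrite -!big_split.
(* After scaling by 6, rows are grouped by class; those of class [ord_max] contribute a nonnegative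
   amount and are dropped. *)
rewrite -(@ler_pMn2r _ 6) // -sumF (partition_big (block R) predT) //=.
rewrite [leRHS](bigD1 ord_max) //= -[leLHS]add0r lerD //.
  by apply: sumr_ge0 => r _; apply: sumr_ge0.
rewrite -sumrMnl; apply: ler_sum => i i_max.
have {i_max} [j Ei] : exists j, i = lift ord_max j.
  by case: (unliftP ord_max i) i_max => [j ->|->]; [exists j | rewrite eqxx].
(* There are $h_i$ rows of class [i], whence the square. *)
suff cell r : block R r == i -> (hext n h i)%:Z * (T i i *+ 6) <= \sum_c F r c.
  apply: le_trans (ler_sum _ cell).
  by rewrite sumr_const cR -[leRHS]mulr_natl natz !mulrnAr mulrA expr2.
(* Columns of class [i] meet this row inside the subsquare, where the symbol also has class [i] and
   [F] equals [6 T i i]. The other cells are bounded below by 0. *)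
move=> ri; rewrite (bigID (fun c => block C c == i)) /= -[leLHS]addr0 lerD //.
  rewrite -natz mulr_natl -(cC i) -sumr_const; apply: ler_sum => c ci.
  have si : block S (L r c) == i.
    move: ri ci; rewrite inE Ei !block_lift //; case: (sub j) => _ _ _ [LS _ _].
    exact: LS.
  rewrite inE in ci; rewrite /F (eqP ri) (eqP ci) (eqP si) !mulrS mulr0n; lra.
by apply: sumr_ge0.
Qed.

Theorem theorem3p2 (n k : nat) (h : 'I_k -> nat)
  (k_ge1 : (1 <= k)%N)
  (h_noninc : forall i j : 'I_k, (i <= j)%N -> (h j <= h i)%N)
  (h_ge1 : forall i : 'I_k, (1 <= h i)%N)
  (sum_h_le : (\sum_(i < k) h i <= n)%N)
  (ils : ILS n h)
  (A B C D : {set 'I_k.+1})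
  (dAB : [disjoint A & B]) (dAC : [disjoint A & C]) (dAD : [disjoint A & D])
  (dBC : [disjoint B & C]) (dBD : [disjoint B & D]) (dCD : [disjoint C & D]) :
  let E := A :|: B :|: C :|: D in
  let x := fun i : 'I_k.+1 => (hext n h i)%:Z in
  (\sum_(i in A :|: C) x i) ^+ 2 + (\sum_(i in B :|: D) x i) ^+ 2
    - \sum_(i in E :\ ord_max) x i ^+ 2
  >= (\sum_(i in A :|: D) x i)
     * (\sum_(i in B :|: C) x i - \sum_(j in ~: E) x j).
Proof.
lazy zeta; set E := A :|: B :|: C :|: D.
set x := fun i : 'I_k.+1 => (hext n h i)%:Z.
pose ind (X : {set 'I_k.+1}) i : int := (i \in X)%:R.
(* Each sum in the inequality is a linear form in [x] with an indicator as coefficients; [T] is the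
   resulting coefficient matrix, not symmetric in general. *)
pose T i j := ind (A :|: C) i * ind (A :|: C) j
  + ind (B :|: D) i * ind (B :|: D) j
  - ind (A :|: D) i * (ind (B :|: C) j - ind (~: E) j).
have sum_ind (X : {set 'I_k.+1}) : \sum_(i in X) x i = \sum_i x i * ind X i.
  by rewrite big_mkcond; apply: eq_bigr => i _; rewrite /ind mulr_natr mulrb.
have memP i : [|| [&& i \in A, i \notin B, i \notin C & i \notin D],
    [&& i \notin A, i \in B, i \notin C & i \notin D],
    [&& i \notin A, i \notin B, i \in C & i \notin D],
    [&& i \notin A, i \notin B, i \notin C & i \in D]
  | [&& i \notin A, i \notin B, i \notin C & i \notin D]].
  move: (@disjointFr _ _ _ i dAB) (@disjointFr _ _ _ i dAC).
  move: (@disjointFr _ _ _ i dAD) (@disjointFr _ _ _ i dBC).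
  move: (@disjointFr _ _ _ i dBD) (@disjointFr _ _ _ i dCD).
  case: (i \in A); case: (i \in B); case: (i \in C); case: (i \in D) => //=;
    by do ?[move/(_ isT) => // | move=> _].
(* By [memP] each index has one of five types, giving 125 cases. [T i j + T j i] is negative, namely
   -1, only between [A] and [B] or between [C] and [D]; the other pairs of the triple always
   compensate. *)
have T_ge0 r c s : 0 <= T r c + T c r + (T c s + T s c) + (T r s + T s r).
  rewrite /T /ind /E !inE; move: (memP r) (memP c) (memP s).
  by case/or4P=> [||| /orP[]] /and4P[];
    do 4![move=> /negPf-> | move=> ->];
    case/or4P=> [||| /orP[]] /and4P[];
    do 4![move=> /negPf-> | move=> ->];
    case/or4P=> [||| /orP[]] /and4P[];
    do 4![move=> /negPf-> | move=> ->].
(* The diagonal of [T] produces exactly the sum of squares over [E :\ ord_max]. *)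
have Tii i : T i i = ind E i.
  rewrite /T /ind /E !inE; move: (memP i).
  by case/or4P=> [||| /orP[]] /and4P[]; do 4![move=> /negPf-> | move=> ->].
have := ILS_quadratic_form ils T_ge0; rewrite -/x.
have -> : \sum_(i | i != ord_max) (hext n h i)%:Z ^+ 2 * T i i
    = \sum_(i in E :\ ord_max) x i ^+ 2.
  rewrite big_mkcond [RHS]big_mkcond; apply: eq_bigr => i _.
  by rewrite Tii /ind in_setD1; case: (i != _); case: (i \in E);
    rewrite ?mulr1 ?mulr0.
have prod_ind (f g : 'I_k.+1 -> int) :
    \sum_i \sum_j x i * x j * (f i * g j) = (\sum_i x i * f i) * (\sum_j x j * g j).
  rewrite big_distrl; apply: eq_bigr => i _; rewrite big_distrr.
  by apply: eq_bigr => j _ /=; ring.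
have -> : \sum_i \sum_j (hext n h i)%:Z * (hext n h j)%:Z * T i j =
    (\sum_(i in A :|: C) x i) ^+ 2 + (\sum_(i in B :|: D) x i) ^+ 2
    - (\sum_(i in A :|: D) x i)
      * (\sum_(i in B :|: C) x i - \sum_(j in ~: E) x j).
  rewrite !sum_ind !expr2 -sumrB.
  under [X in _ - _ * X]eq_bigr => i _ do rewrite -mulrBr.
  rewrite -!prod_ind -big_split -sumrB; apply: eq_bigr => i _ /=.
  rewrite -big_split -sumrB; apply: eq_bigr => j _ /=.
  by rewrite /T -/(x i) -/(x j) mulrBr mulrDr.
lra.
Qed.
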